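(* Suppose that the following hypothesis holds: the sequence of determinant polynomials $(\det_n:\mathbb{C}^{n\times n}\to\mathbb{C})_{n>0}$ is $\mathbf{VP}_{\mathbb{C}}$-complete (in Valiant's sense). Then the sequence $$\left(\mathrm{weighted\text{-}det}_n:\mathbb{C}^{n\times n\times n}\to\mathbb{C}\right)_{n>0},\qquad \mathrm{weighted\text{-}det}_n(A_1,\ldots,A_n)=\sum_{i=1}^n2^i\cdot\mathbf{1}_{\det(A_i)=0}\quad(A_1,\dots,A_n\in\mathbb{C}^{n\times n}),$$ is $\mathbf{VP}_{\mathbb{C}}^{\mathbb{C}}$-complete.
   Context: Valiant's class $\mathbf{VP}_{\mathbb{C}}$: sequences of complex polynomials whose number of variables, degree and arithmetic circuit (straight-line program) complexity are polynomially bounded in $n$. For polynomial sequences, $(P_n)\le_p(Q_n)$ means that, for some polynomially bounded $t(n)$, $P_n$ is obtained from $Q_{t(n)}$ by substituting for each variable of $Q_{t(n)}$ a variable of $P_n$ or a constant in $\mathbb{C}$. $(Q_n)$ is $\mathbf{VP}_{\mathbb{C}}$-complete if it lies in $\mathbf{VP}_{\mathbb{C}}$ and every sequence in $\mathbf{VP}_{\mathbb{C}}$ is $\le_p(Q_n)$. A constructible function $f:\mathbb{C}^n\to\mathbb{C}$ is a finite $\mathbb{C}$-linear combination of characteristic functions of constructible sets. $\mathrm{Par}(f)$ is the partition of $\mathbb{C}^n$ into level sets of $f$; $\mathcal{A}'\prec\mathcal{A}$ means that every set of the partition $\mathcal{A}'$ is contained in a set of the partition $\mathcal{A}$. Formulas: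 $\mathbf{1}_{P=0},\mathbf{1}_{P\ne0}$ for complex polynomials $P$ are formulas; if $F_1,F_2$ are formulas and $c\in\mathbb{C}$, then $F_1+F_2$, $F_1\cdot F_2$, $c\cdot F_1$ are formulas, and for $h\in\mathbb{C}[T]$, $h(F_1)$ is also regarded as a formula. For a polynomial $P$, $\mathrm{size}(P)$ is the maximum of $\deg P$ and the length of the shortest straight-line program computing $P$. The size of $\mathbf{1}_{P=0}$ and $\mathbf{1}_{P\ne0}$ is $\mathrm{size}(P)$; $\mathrm{size}(F_1+F_2)=\mathrm{size}(F_1\cdot F_2)=\mathrm{size}(F_1)+\mathrm{size}(F_2)$; $\mathrm{size}(h(F))=\mathrm{size}(F)$ for $h\in\mathbb{C}[T]$. $\mathbf{VP}_{\mathbb{C}}^{\mathbb{C}}$: a sequence of constructible functions $(f_n:\mathbb{C}^{m(n)}\to\mathbb{C})_{n>0}$ ($m(n)$ a non-negative integer polynomial) is in $\mathbf{VP}_{\mathbb{C}}^{\mathbb{C}}$ if for each $n$ there is a formula $F_n$ defining $f_n$ with $\mathrm{size}(F_n)$ bounded by a polynomial in $n$. Reduction of constructible functions: for $(f_n:\mathbb{C}^{m_1(n)}\to\mathbb{C})_{n>0}$ and $(g_n:\mathbb{C}^{m_2(n)}\to\mathbb{C})_{n>0}$, $(f_n)\le_p(g_n)$ means there are a polynomially bounded $t:\mathbb{N}\to\mathbb{N}$ and, for each $n>0$, a map $Z:\{1,\ldots,m_2(t(n))\}\to\{X_1,\ldots,X_{m_1(n)}\}\cup\mathbb{C}$ such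 that $\bar f_n(X_1,\ldots,X_{m_1(n)})=g_{t(n)}(Z(1),\ldots,Z(m_2(t(n))))$ satisfies $\mathrm{Par}(\bar f_n)\prec\mathrm{Par}(f_n)$. A sequence is $\mathbf{VP}_{\mathbb{C}}^{\mathbb{C}}$-complete if it belongs to $\mathbf{VP}_{\mathbb{C}}^{\mathbb{C}}$ and every sequence in $\mathbf{VP}_{\mathbb{C}}^{\mathbb{C}}$ is $\le_p$ it. *)

(* Defs.v *)
From HB Require Import structures.
From mathcomp Require Import all_boot all_order all_algebra.
From mathcomp Require Import boolp classical_sets reals.
From mathcomp Require Import complex mpoly.

Set Implicit Arguments.
Unset Strict Implicit.
Unset Printing Implicit Defensive.

Import GRing.Theory.
Local Open Scope ring_scope.

(* Every sequence is indexed by the integers n > 0: as Rocq functions on nat    *)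
(* they also have a value at 0, but no definition below depends on it.          *)

Definition poly_bounded (u : nat -> nat) : Prop :=
  exists p : {poly nat}, forall n : nat, (0 < n)%N -> (u n <= p.[n])%N.

(* m agrees, on n > 0, with a polynomial with integer coefficients.             *)
Definition poly_nat (m : nat -> nat) : Prop :=
  exists p : {poly int}, forall n : nat, (0 < n)%N -> (m n)%:Z = p.[n%:Z].

Section StraightLinePrograms.
Variables (K : fieldType) (n : nat).

(* The operands of an instruction are positions in the list made of the n       *)
(* variables followed by the results of the earlier instructions.               *)
Inductive slp_instr : Type :=
| SConst of K
| SAdd of nat & nat
| SSub of nat & nat
| SMul of nat & nat.

Definition slp := seq slp_instr.

Definition instr_wf (k : nat) (a : slp_instr) : bool :=
  match a with
  | SConst _ => true
  | SAdd i j | SSub i j | SMul i j => (i < k)%N && (j < k)%N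
  end.

Fixpoint slp_wf (k : nat) (s : slp) : bool :=
  if s is a :: s' then instr_wf k a && slp_wf k.+1 s' else true.

Definition instr_val (w : seq {mpoly K[n]}) (a : slp_instr) : {mpoly K[n]} :=
  match a with
  | SConst c => c%:MP
  | SAdd i j => w`_i + w`_j
  | SSub i j => w`_i - w`_j
  | SMul i j => w`_i * w`_j
  end.

Fixpoint slp_run (w : seq {mpoly K[n]}) (s : slp) : seq {mpoly K[n]} :=
  if s is a :: s' then slp_run (rcons w (instr_val w a)) s' else w.

Definition slp_inputs : seq {mpoly K[n]} := [seq 'X_i | i <- enum 'I_n].

Definition slp_computes (s : slp) (P : {mpoly K[n]}) : bool :=
  slp_wf n s && (P \in slp_run slp_inputs s).

Lemma slp_run_cat w s1 s2 : slp_run w (s1 ++ s2) = slp_run (slp_run w s1) s2.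
Proof. by elim: s1 w => //= a s1 IH w; rewrite IH. Qed.

Lemma size_slp_run w s : size (slp_run w s) = (size w + size s)%N.
Proof.
by elim: s w => [|a s IH] w /=; rewrite ?addn0 // IH size_rcons addnS.
Qed.

Lemma slp_wf_cat k s1 s2 :
  slp_wf k (s1 ++ s2) = slp_wf k s1 && slp_wf (k + size s1) s2.
Proof.
by elim: s1 k => [|a s1 IH] k /=; rewrite ?addn0 // IH addnS andbA.
Qed.

Lemma sub_slp_run w s : {subset w <= slp_run w s}.
Proof.
elim: s w => [|a s IH] w P Pw //=; apply: (IH (rcons w _)) => /=.
by rewrite mem_rcons inE Pw orbT.
Qed.

Let reachable (P : {mpoly K[n]}) := forall w : seq {mpoly K[n]},
  {subset slp_inputs <= w} ->
  exists2 s : slp, slp_wf (size w) s & P \in slp_run w s.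

Let reachable_bin (mk : nat -> nat -> slp_instr)
    (op : {mpoly K[n]} -> {mpoly K[n]} -> {mpoly K[n]}) :
  (forall w i j, instr_val w (mk i j) = op w`_i w`_j) ->
  (forall k i j, instr_wf k (mk i j) = (i < k)%N && (j < k)%N) ->
  forall P Q, reachable P -> reachable Q -> reachable (op P Q).
Proof.
move=> mkV mkW P Q rP rQ w inw; have [s1 wf1 Ps1] := rP w inw.
have inw1 : {subset slp_inputs <= slp_run w s1}.
  by move=> x /inw; apply: sub_slp_run.
have [s2 wf2 Qs2] := rQ _ inw1.
set w2 := slp_run _ s2 in Qs2; have Pw2 : P \in w2 by apply: sub_slp_run.
exists (s1 ++ s2 ++ [:: mk (index P w2) (index Q w2)]).
  rewrite !slp_wf_cat wf1 -size_slp_run wf2 -size_slp_run /= mkW.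
  by rewrite !index_mem Pw2 Qs2.
by rewrite !slp_run_cat /= mkV !nth_index // mem_rcons mem_head.
Qed.

Lemma slp_exists (P : {mpoly K[n]}) :
  exists k, `[< exists2 s : slp, slp_computes s P & size s = k >].
Proof.
have rC c : reachable c%:MP.
  by move=> w _; exists [:: SConst c] => //=; rewrite mem_rcons mem_head.
have rX i : reachable 'X_i.
  by move=> w inw; exists [::] => //=; apply/inw/map_f; rewrite mem_enum.
have rD := @reachable_bin SAdd +%R (fun _ _ _ => erefl) (fun _ _ _ => erefl).
have rM := @reachable_bin SMul *%R (fun _ _ _ => erefl) (fun _ _ _ => erefl).
have rXn i k : reachable ('X_i ^+ k).
  by elim: k => [|k IH]; rewrite ?exprS; [apply: rC 1 | apply: rM].
have rP : reachable P.
  elim/mpolyind: P => [|c m p _ _ IH]; first by rewrite -mpolyC0.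
  apply: (rD) => //; rewrite -mul_mpolyC; apply: (rM) => //.
  rewrite mpolyXE_id; apply: big_ind; [exact: (rC 1) | exact: rM |].
  by move=> i _; apply: rXn.
have [s wf_s Ps] := rP slp_inputs (fun x => id).
exists (size s); apply/asboolP; exists s => //; apply/andP; split=> //.
by rewrite /slp_inputs size_map size_enum_ord in wf_s.
Qed.

Definition slp_complexity (P : {mpoly K[n]}) : nat := ex_minn (slp_exists P).

Definition mpoly_degree (P : {mpoly K[n]}) : nat := (msize P).-1.

Definition mpoly_size (P : {mpoly K[n]}) : nat :=
  maxn (mpoly_degree P) (slp_complexity P).

End StraightLinePrograms.

Section Valiant.
Variable K : fieldType.

Definition in_VP (v : nat -> nat) (P : forall n, {mpoly K[v n]}) : Prop :=
  [/\ poly_bounded v,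
      poly_bounded (fun n => mpoly_degree (P n)) &
      poly_bounded (fun n => slp_complexity (P n))].

Definition subst_mpoly (a b : nat) (Z : 'I_a -> 'I_b + K) (Q : {mpoly K[a]}) :
    {mpoly K[b]} :=
  Q \mPo [tuple match Z i with inl j => 'X_j | inr c => c%:MP end | i < a].

Definition poly_reduces (v : nat -> nat) (P : forall n, {mpoly K[v n]})
    (w : nat -> nat) (Q : forall n, {mpoly K[w n]}) : Prop :=
  exists t : nat -> nat, poly_bounded t /\
    forall n, (0 < n)%N -> (0 < t n)%N /\
      exists Z : 'I_(w (t n)) -> 'I_(v n) + K, P n = subst_mpoly Z (Q (t n)).

Definition VP_complete (w : nat -> nat) (Q : forall n, {mpoly K[w n]}) : Prop :=
  in_VP Q /\
  forall (v : nat -> nat) (P : forall n, {mpoly K[v n]}),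
    in_VP P -> poly_reduces P Q.

Definition det_mpoly (n : nat) : {mpoly K[n * n]} :=
  \det (\matrix_(i < n, j < n) 'X_(mxvec_index i j)).

End Valiant.

Section ConstructibleFunctions.
Variable K : fieldType.
Local Open Scope classical_set_scope.

Inductive constructible_set (n : nat) : set 'rV[K]_n -> Prop :=
| constructible_zero (P : {mpoly K[n]}) :
    constructible_set [set x : 'rV[K]_n | P.@[x 0] = 0]
| constructible_setC (A : set 'rV[K]_n) :
    constructible_set A -> constructible_set (~` A)
| constructible_setU (A B : set 'rV[K]_n) :
    constructible_set A -> constructible_set B -> constructible_set (A `|` B).

Definition constructible_fun (n : nat) (f : 'rV[K]_n -> K) : Prop :=
  exists (k : nat) (c : 'I_k -> K) (A : 'I_k -> set 'rV[K]_n),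
    (forall i, constructible_set (A i)) /\
    (forall x, f x = \sum_(i < k) c i * (x \in A i)%:R).

Definition Par (n : nat) (f : 'rV[K]_n -> K) : set (set 'rV[K]_n) :=
  [set f @^-1` [set c] | c in range f].

Definition refines (T : Type) (A' A : set (set T)) : Prop :=
  forall S', A' S' -> exists2 S, A S & S' `<=` S.

Inductive formula (n : nat) : Type :=
| FEq of {mpoly K[n]}
| FNeq of {mpoly K[n]}
| FAdd of formula n & formula n
| FMul of formula n & formula n
| FScale of K & formula n
| FPoly of {poly K} & formula n.

Fixpoint formula_val (n : nat) (F : formula n) (x : 'rV[K]_n) : K :=
  match F with
  | FEq P => (P.@[x 0] == 0)%:R
  | FNeq P => (P.@[x 0] != 0)%:R
  | FAdd F1 F2 => formula_val F1 x + formula_val F2 x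
  | FMul F1 F2 => formula_val F1 x * formula_val F2 x
  | FScale c F1 => c * formula_val F1 x
  | FPoly h F1 => h.[formula_val F1 x]
  end.

(* c . F is h(F) for h = c T, whence the size of FScale.                        *)
Fixpoint formula_size (n : nat) (F : formula n) : nat :=
  match F with
  | FEq P | FNeq P => mpoly_size P
  | FAdd F1 F2 | FMul F1 F2 => (formula_size F1 + formula_size F2)%N
  | FScale _ F1 | FPoly _ F1 => formula_size F1
  end.

Definition in_VPC (m : nat -> nat) (f : forall n, 'rV[K]_(m n) -> K) : Prop :=
  [/\ poly_nat m,
      forall n, (0 < n)%N -> constructible_fun (f n) &
      exists F : forall n, formula (m n),
        (forall n, (0 < n)%N -> forall x, formula_val (F n) x = f n x) /\
        poly_bounded (fun n => formula_size (F n))].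

Definition subst_fun (a b : nat) (Z : 'I_a -> 'I_b + K) (g : 'rV[K]_a -> K)
    (x : 'rV[K]_b) : K :=
  g (\row_(i < a) match Z i with inl j => x 0 j | inr c => c end).

Definition fun_reduces (m1 : nat -> nat) (f : forall n, 'rV[K]_(m1 n) -> K)
    (m2 : nat -> nat) (g : forall n, 'rV[K]_(m2 n) -> K) : Prop :=
  exists t : nat -> nat, poly_bounded t /\
    forall n, (0 < n)%N -> (0 < t n)%N /\
      exists Z : 'I_(m2 (t n)) -> 'I_(m1 n) + K,
        refines (Par (subst_fun Z (g (t n)))) (Par (f n)).

Definition VPC_complete (m : nat -> nat) (g : forall n, 'rV[K]_(m n) -> K) :
    Prop :=
  in_VPC g /\
  forall (m' : nat -> nat) (f : forall n, 'rV[K]_(m' n) -> K),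
    in_VPC f -> fun_reduces f g.

(* The exponent is i + 1 because 'I_n starts at 0.                              *)
Definition weighted_det (n : nat) (A : 'I_n -> 'M[K]_n) : K :=
  \sum_(i < n) 2 ^+ i.+1 * (\det (A i) == 0)%:R.

(* C^(n x n x n) is 'rV_(n * (n * n)), its vectors read as n successive blocks  *)
(* of length n * n.                                                             *)
Definition weighted_det_seq (n : nat) (x : 'rV[K]_(n * (n * n))) : K :=
  weighted_det (fun i => vec_mx (row i (vec_mx x))).

End ConstructibleFunctions.

(* Main.v *)
Require Import Defs.
From mathcomp Require Import all_boot all_order all_algebra.
From mathcomp Require Import reals complex mpoly.
From mathcomp Require Import boolp classical_sets zify.

(* A formula only sees which of the polynomials P_1, ..., P_k in its atoms      *)
(* vanish, and the sum of 2^i 1_(P_i = 0) determines all these bits.  Since     *)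
(* every atom has size at least 1, k is bounded by the size of the formula, so  *)
(* sum_j Y_j P_j lies in VP and is a projection of some det_t; specializing Y   *)
(* to unit vectors makes every P_j a projection of this same det_t.             *)

Set Implicit Arguments.
Unset Strict Implicit.
Unset Printing Implicit Defensive.

Import Order.TTheory GRing.Theory Num.Theory.
Local Open Scope ring_scope.

(** Membership: [weighted_det_seq] is by definition a combination of [n] atoms, each the determinant
    of one block of variables, and renaming variables does not increase [mpoly_size]; so the VP
    bounds on the determinant suffice ([in_VPC_weighted_det]).

    Hardness: the reduction only has to separate points with different values of [f n]. The weights
    2^i make the weighted determinant a binary code of the vanishing pattern of its blocks
    ([weighted_det_inj]), and the vanishing pattern of the atoms fixes the value of a formula
    ([formula_val_atoms]). It remains to write all atoms as determinants of one common order.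
    Completeness of the determinant yields one order per sequence element, so the atoms are first
    merged into the single polynomial [packed] and then recovered from its projection
    ([packed_subst]). Padding by identity blocks fits these determinants into one weighted
    determinant ([subst_pad]). *)

(** * Polynomially bounded sequences *)

Lemma poly_bounded_le (u v : nat -> nat) :
  poly_bounded v -> (forall n, (0 < n)%N -> (u n <= v n)%N) -> poly_bounded u.
Proof.
by move=> [p hp] le_uv; exists p => n n0; apply: leq_trans (le_uv n n0) (hp n n0).
Qed.

Lemma poly_boundedC (c : nat) : poly_bounded (fun=> c).
Proof. by exists c%:P => n _; rewrite hornerC. Qed.

Lemma poly_bounded_id : poly_bounded id.
Proof. by exists 'X => n _; rewrite hornerX. Qed.

Lemma poly_boundedD (u v : nat -> nat) :
  poly_bounded u -> poly_bounded v -> poly_bounded (fun n => u n + v n)%N.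
Proof.
by move=> [p hp] [q hq]; exists (p + q) => n n0; rewrite hornerD leq_add ?hp ?hq.
Qed.

Lemma poly_boundedM (u v : nat -> nat) :
  poly_bounded u -> poly_bounded v -> poly_bounded (fun n => u n * v n)%N.
Proof.
by move=> [p hp] [q hq]; exists (p * q) => n n0; rewrite hornerM leq_mul ?hp ?hq.
Qed.

(** Integer coefficients may be negative; their absolute values give the bound. *)
Lemma poly_nat_bounded (m : nat -> nat) : poly_nat m -> poly_bounded m.
Proof.
move=> [p hp].
have bsum k : poly_bounded (fun n => \sum_(i < k) absz (p`_i)%R * n ^ i)%N.
  elim: k => [|k IH].
    by apply: poly_bounded_le (poly_boundedC 0) _ => n _; rewrite big_ord0.
  apply: poly_bounded_le (_ : poly_bounded (fun n =>
    (\sum_(i < k) absz (p`_i)%R * n ^ i) + absz (p`_k)%R * n ^ k)%N) _; last first.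
    by move=> n _; rewrite big_ord_recr.
  apply: poly_boundedD IH (poly_boundedM (poly_boundedC _) _).
  elim: k => [|k IH]; first exact: poly_boundedC 1%N.
  by apply: poly_bounded_le (poly_boundedM poly_bounded_id IH) _ => n _; rewrite expnS.
apply: poly_bounded_le (bsum (size p)) _ => n n0.
rewrite -lez_nat hp // horner_coef; apply: le_trans (ler_norm _) _.
apply: le_trans (ler_norm_sum _ _ _) _.
rewrite (big_morph Posz PoszD (erefl _)) /=; apply: ler_sum => i _.
by rewrite PoszM normrM normrX abszE -rmorphXn /=.
Qed.

(* Sharper by two than the library's [msizeM_le], which holds over any ring. *)
Lemma msizeM_field_le (K : fieldType) (n : nat) (p q : {mpoly K[n]}) :
  (msize (p * q) <= (msize p + msize q).-1)%N.
Proof.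
have [->|p0] := eqVneq p 0; first by rewrite mul0r mmeasure0.
have [->|q0] := eqVneq q 0; first by rewrite mulr0 mmeasure0.
by rewrite msizeM.
Qed.

(** * Substitution and renaming of variables *)

Section Rename.
Variables (K : fieldType) (a b : nat).
Implicit Types (P : {mpoly K[a]}) (sigma : 'I_a -> 'I_b).

(** Each variable is replaced by a polynomial of degree at most 1, so no monomial gains degree. *)
Lemma msize_subst_le (Z : 'I_a -> 'I_b + K) P :
  (msize (subst_mpoly Z P) <= msize P)%N.
Proof.
rewrite /subst_mpoly comp_mpolyE; set lq := [tuple _ | i < a].
apply: leq_trans (mmeasure_sum _ _ _ _) _; apply/bigmax_leqP_seq => m mP _.
apply: leq_trans (msizeZ_le _ _) (leq_trans _ (msize_mdeg_lt mP)).
rewrite mdegE; elim/big_rec2: _ => [|i q d _ leq]; first by rewrite msize1.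
suff le_i : (msize (tnth lq i ^+ m i) <= (m i).+1)%N.
  by have := msizeM_field_le (tnth lq i ^+ m i) q; lia.
have le2 : (msize (tnth lq i) <= 2)%N.
  rewrite tnth_mktuple; case: (Z i) => [j|c].
    by rewrite msizeX mdeg1.
  by rewrite mmeasureC; case: (c != 0).
elim: (m i) => [|k IH]; first by rewrite expr0 msize1.
by rewrite exprS; have := msizeM_field_le (tnth lq i) (tnth lq i ^+ k); lia.
Qed.

Lemma mpoly_degree_subst_le (Z : 'I_a -> 'I_b + K) P :
  (mpoly_degree (subst_mpoly Z P) <= mpoly_degree P)%N.
Proof. by rewrite /mpoly_degree; have := msize_subst_le Z P; lia. Qed.

Lemma meval_subst (Z : 'I_a -> 'I_b + K) P (v : 'I_b -> K) :
  (subst_mpoly Z P).@[v] =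
  P.@[fun i => match Z i with inl j => v j | inr c => c end].
Proof.
rewrite /subst_mpoly comp_mpoly_meval; apply: meval_eq => i.
by rewrite tnth_mktuple; case: (Z i) => [j|c]; rewrite ?mevalXU ?mevalC.
Qed.

Definition rename sigma P : {mpoly K[b]} := subst_mpoly (fun i => inl (sigma i)) P.

Lemma renameC sigma c : rename sigma c%:MP = c%:MP.
Proof. exact: comp_mpolyC. Qed.

Lemma renameX sigma i : rename sigma 'X_i = 'X_(sigma i).
Proof. by rewrite /rename /subst_mpoly comp_mpolyXU -tnth_nth tnth_mktuple. Qed.

Lemma renameD sigma : {morph rename sigma : P Q / P + Q}.
Proof. by move=> P Q; rewrite /rename /subst_mpoly raddfD. Qed.

Lemma renameB sigma : {morph rename sigma : P Q / P - Q}.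
Proof. by move=> P Q; rewrite /rename /subst_mpoly raddfB. Qed.

Lemma renameM sigma : {morph rename sigma : P Q / P * Q}.
Proof. by move=> P Q; rewrite /rename /subst_mpoly rmorphM. Qed.

End Rename.

(** * Upper bounds on straight-line complexity *)

Section Cost.
Variables (K : fieldType) (n : nat).
Implicit Types P Q : {mpoly K[n]}.

(** Allowing any memory [w] that contains the inputs makes the bound composable: a program for [P]
    can be continued by one for [Q], and the results are then located by value with [index]. *)
Definition slp_cost_le (c : nat) P := forall w : seq {mpoly K[n]},
  {subset slp_inputs K n <= w} ->
  exists s : slp K, [/\ slp_wf (size w) s, (size s <= c)%N & P \in slp_run w s].

Lemma slp_complexity_le c P : slp_cost_le c P -> (slp_complexity P <= c)%N.
Proof.
move=> /(_ _ (fun=> id))[s [wfs les Ps]]; apply: leq_trans les.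
rewrite /slp_complexity; case: ex_minnP => k _; apply.
apply/asboolP; exists s => //; apply/andP; split=> //.
by rewrite /slp_inputs size_map size_enum_ord in wfs.
Qed.

Lemma slp_cost_leX i : slp_cost_le 0 'X_i.
Proof.
by move=> w inw; exists [::]; split=> //=; apply/inw/map_f; rewrite mem_enum.
Qed.

Lemma slp_cost_leC c : slp_cost_le 1 c%:MP.
Proof. by move=> w _; exists [:: SConst c]; split=> //=; rewrite mem_rcons mem_head. Qed.

Lemma slp_cost_le_seq c P d Q (w : seq {mpoly K[n]}) :
  slp_cost_le c P -> slp_cost_le d Q -> {subset slp_inputs K n <= w} ->
  exists s : slp K, [/\ slp_wf (size w) s, (size s <= c + d)%N,
    P \in slp_run w s & Q \in slp_run w s].
Proof.
move=> rP rQ inw; have [s1 [wf1 le1 Ps1]] := rP w inw.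
have [s2 [wf2 le2 Qs2]] : exists s2 : slp K, [/\ slp_wf (size (slp_run w s1)) s2,
    (size s2 <= d)%N & Q \in slp_run (slp_run w s1) s2].
  by apply: rQ => x /inw; apply: sub_slp_run.
exists (s1 ++ s2); rewrite slp_wf_cat wf1 -size_slp_run wf2 size_cat leq_add //.
by rewrite slp_run_cat (sub_slp_run _ Ps1).
Qed.

Lemma slp_cost_leD c P d Q :
  slp_cost_le c P -> slp_cost_le d Q -> slp_cost_le (c + d).+1 (P + Q).
Proof.
move=> rP rQ w inw; have [s [wfs les Ps Qs]] := slp_cost_le_seq rP rQ inw.
exists (rcons s (SAdd K (index P (slp_run w s)) (index Q (slp_run w s)))).
rewrite -cats1 slp_wf_cat wfs -size_slp_run /= !index_mem Ps Qs size_cat addn1.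
by rewrite slp_run_cat /= !nth_index // mem_rcons mem_head.
Qed.

Lemma slp_cost_leM c P d Q :
  slp_cost_le c P -> slp_cost_le d Q -> slp_cost_le (c + d).+1 (P * Q).
Proof.
move=> rP rQ w inw; have [s [wfs les Ps Qs]] := slp_cost_le_seq rP rQ inw.
exists (rcons s (SMul K (index P (slp_run w s)) (index Q (slp_run w s)))).
rewrite -cats1 slp_wf_cat wfs -size_slp_run /= !index_mem Ps Qs size_cat addn1.
by rewrite slp_run_cat /= !nth_index // mem_rcons mem_head.
Qed.

(** One addition per summand, and one constant instruction for the empty sum. *)
Lemma slp_cost_le_sum (k : nat) (c : 'I_k -> nat) (F : 'I_k -> {mpoly K[n]}) :
  (forall i, slp_cost_le (c i) (F i)) ->
  slp_cost_le (\sum_(i < k) (c i).+1).+1 (\sum_(i < k) F i).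
Proof.
elim: k c F => [|k IH] c F cF; first by rewrite !big_ord0; apply: slp_cost_leC 0.
rewrite !big_ord_recl; set d := (\sum_(i < k) _)%N.
have -> : (((c ord0).+1 + d).+1 = (c ord0 + d.+1).+1)%N by lia.
by apply: slp_cost_leD (cF _) (IH _ _ _) => i; apply: cF.
Qed.

End Cost.

Section RenameCost.
Variables (K : fieldType) (a b : nat) (sigma : 'I_a -> 'I_b).

(** The program is translated one instruction at a time. The invariant is that [w] contains the
    renaming of everything in [u], so each operand can be looked up by value in [w], whose layout
    may differ. *)
Lemma slp_run_rename (s : slp K) (u : seq {mpoly K[a]}) (w : seq {mpoly K[b]}) :
    slp_wf (size u) s -> (forall P, P \in u -> rename sigma P \in w) ->
  exists s' : slp K, [/\ slp_wf (size w) s', size s' = size s &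
    forall P, P \in slp_run u s -> rename sigma P \in slp_run w s'].
Proof.
elim: s u w => [|i s IH] u w /=; first by move=> _ uw; exists [::].
case/andP=> wfi wfs uw.
suff [i' wfi' vi'] : exists2 i' : slp_instr K, instr_wf (size w) i' &
    instr_val w i' = rename sigma (instr_val u i).
  have [||s' [wfs' sz_s' Ps']] := IH (rcons u (instr_val u i)) (rcons w (instr_val w i')).
  - by rewrite size_rcons.
  - move=> P; rewrite !mem_rcons !inE => /orP[/eqP->|/uw ->]; rewrite ?orbT //.
    by rewrite vi' eqxx.
  exists (i' :: s'); split=> //=; last by rewrite sz_s'.
  by rewrite wfi'; rewrite size_rcons in wfs'.
pose pos j := index (rename sigma u`_j) w.
have posP j : (j < size u)%N -> (pos j < size w)%N /\ w`_(pos j) = rename sigma u`_j.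
  by move=> /(mem_nth 0)/uw wj; rewrite index_mem nth_index.
case: i wfi => [c|i j|i j|i j] /=; first by exists (SConst c); rewrite /= ?renameC.
all: move=> /andP[/posP[lti wi] /posP[ltj wj]].
- by exists (SAdd K (pos i) (pos j)); [rewrite /= lti | rewrite /instr_val wi wj -renameD].
- by exists (SSub K (pos i) (pos j)); [rewrite /= lti | rewrite /instr_val wi wj -renameB].
- by exists (SMul K (pos i) (pos j)); [rewrite /= lti | rewrite /instr_val wi wj -renameM].
Qed.

Lemma slp_cost_le_rename (P : {mpoly K[a]}) :
  slp_cost_le (slp_complexity P) (rename sigma P).
Proof.
move=> w inw; rewrite /slp_complexity; case: ex_minnP => k + _.
move=> /asboolP[s /andP[wfs Ps] <-].
have [||s' [wfs' <- sub]] := @slp_run_rename s (slp_inputs K a) w.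
- by rewrite /slp_inputs size_map size_enum_ord.
- move=> _ /mapP[i _ ->]; apply: inw; rewrite renameX; apply: map_f.
  by rewrite mem_enum.
by exists s'; split=> //; apply: sub.
Qed.

Lemma mpoly_size_rename (P : {mpoly K[a]}) :
  (mpoly_size (rename sigma P) <= mpoly_size P)%N.
Proof.
rewrite /mpoly_size geq_max !leq_max mpoly_degree_subst_le.
by rewrite (slp_complexity_le (slp_cost_le_rename P)) orbT.
Qed.

End RenameCost.

(* A polynomial of complexity 0 is a variable, and has degree 1. *)
Lemma mpoly_size_gt0 (K : fieldType) (n : nat) (P : {mpoly K[n]}) :
  (0 < mpoly_size P)%N.
Proof.
rewrite /mpoly_size /slp_complexity; case: ex_minnP => k + _.
move=> /asboolP[s /andP[_ Ps] <-]; rewrite leq_max; case: s Ps => [|i s] /=; last by rewrite orbT.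
by move=> /mapP[i _ ->]; rewrite /mpoly_degree msizeX mdeg1.
Qed.

(** * Formulas and the vanishing of their atoms *)

Section Atoms.
Variables (K : fieldType) (n : nat).

Fixpoint atoms (F : formula K n) : seq {mpoly K[n]} :=
  match F with
  | FEq P | FNeq P => [:: P]
  | FAdd F1 F2 | FMul F1 F2 => atoms F1 ++ atoms F2
  | FScale _ F1 | FPoly _ F1 => atoms F1
  end.

Lemma formula_sizeE (F : formula K n) :
  formula_size F = (\sum_(P <- atoms F) mpoly_size P)%N.
Proof.
elim: F => [P|P|F1 IH1 F2 IH2|F1 IH1 F2 IH2|c F IH|h F IH] //=;
  by rewrite ?big_seq1 ?big_cat // IH1 IH2.
Qed.

Lemma formula_val_atoms (F : formula K n) (x y : 'rV[K]_n) :
    (forall P, P \in atoms F -> (P.@[x 0] == 0) = (P.@[y 0] == 0)) ->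
  formula_val F x = formula_val F y.
Proof.
elim: F => [P|P|F1 IH1 F2 IH2|F1 IH1 F2 IH2|c F IH|h F IH] /= eqxy;
  rewrite ?eqxy ?mem_head ?IH //.
  by rewrite IH1 ?IH2 // => P PF; apply: eqxy; rewrite mem_cat PF ?orbT.
by rewrite IH1 ?IH2 // => P PF; apply: eqxy; rewrite mem_cat PF ?orbT.
Qed.

End Atoms.

(** Uniqueness of binary digits: half the sum is the lowest bit plus an even number, so its parity
    gives that bit, and induction gives the others. *)
Lemma sum_pow2_inj (N : nat) (b c : nat -> bool) :
    (\sum_(i < N) 2 ^ i.+1 * b i = \sum_(i < N) 2 ^ i.+1 * c i)%N ->
  forall i, (i < N)%N -> b i = c i.
Proof.
have shift (d : nat -> bool) k : (\sum_(i < k.+1) 2 ^ i.+1 * nat_of_bool (d i) =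
    2 * (d 0%N + \sum_(i < k) 2 ^ i.+1 * nat_of_bool (d i.+1)))%N.
  rewrite big_ord_recl expn1 mulnDr; congr (_ + _)%N.
  by rewrite big_distrr; apply: eq_bigr => i _; rewrite expnS -mulnA.
have even (d : nat -> bool) k : (exists m, \sum_(i < k) 2 ^ i.+1 * nat_of_bool (d i) = 2 * m)%N.
  by case: k => [|k]; [exists 0%N; rewrite big_ord0 | eexists; apply: shift].
elim: N b c => [//|N IH] b c; rewrite !shift.
have [[p eb] [q ec]] := (even (fun i => b i.+1) N, even (fun i => c i.+1) N).
move=> e [|i] lt_i; first by move: e; rewrite eb ec; case: (b 0%N) (c 0%N) => [] []; lia.
apply: (IH (fun i => b i.+1) (fun i => c i.+1)) lt_i.
by move: e; rewrite eb ec; case: (b 0%N) (c 0%N) => [] []; lia.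
Qed.

(** * The weighted determinant has small formulas *)

Section Membership.
Variable K : fieldType.

Definition block_det (n : nat) (i : 'I_n) : {mpoly K[n * (n * n)]} :=
  rename (mxvec_index i) (det_mpoly K n).

Lemma meval_subst_det (a b : nat) (Z : 'I_(a * a) -> 'I_b + K) (v : 'I_b -> K) :
  (subst_mpoly Z (det_mpoly K a)).@[v] =
  \det (vec_mx (\row_p match Z p with inl j => v j | inr c => c end) : 'M_a).
Proof.
rewrite meval_subst /det_mpoly -det_map_mx; congr (\det _).
by apply/matrixP => i j; rewrite !mxE /= mevalXU.
Qed.

Lemma meval_block_det (n : nat) (i : 'I_n) (x : 'rV[K]_(n * (n * n))) :
  (block_det i).@[x 0] = \det (vec_mx (row i (vec_mx x)) : 'M_n).
Proof.
rewrite meval_subst_det; congr (\det (vec_mx _)).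
by apply/rowP => p; rewrite !mxE.
Qed.

Lemma in_VPC_weighted_det : in_VP (@det_mpoly K) -> in_VPC (@weighted_det_seq K).
Proof.
case=> _ deg_det slp_det; split.
- by exists ('X * ('X * 'X)) => n _; rewrite !hornerM !hornerX.
- move=> n _; exists n, (fun i => 2 ^+ i.+1).
  exists (fun i => [set x : 'rV[K]_(n * (n * n)) | (block_det i).@[x 0] = 0]%classic).
  split=> [i|x]; first exact: constructible_zero.
  apply: eq_bigr => i _; rewrite -meval_block_det; congr (_ * _%:R); congr nat_of_bool.
  by apply/eqP/idP; rewrite inE.
(* There is no empty formula: the fold ends in 0 times the indicator of 0 = 0, an atom of size at
   most 1. *)
exists (fun n => foldr (fun i : 'I_n => FAdd (FScale (2 ^+ i.+1) (FEq (block_det i))))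
  (FScale 0 (FEq 0)) (enum 'I_n)).
split=> [n _ x|].
  rewrite /weighted_det_seq /weighted_det -big_enum /=.
  elim: (enum 'I_n) => [|i e IH] /=; first by rewrite big_nil mul0r.
  by rewrite big_cons IH meval_block_det.
have bnd := poly_boundedM poly_bounded_id (poly_boundedD deg_det slp_det).
apply: poly_bounded_le (poly_boundedD bnd (poly_boundedC 1)) _ => n _.
rewrite -[X in (_ <= X * _ + _)%N](size_enum_ord n).
elim: (enum 'I_n) => [|i e IH] /=.
  rewrite /mpoly_size /mpoly_degree mmeasure0 max0n; apply: slp_complexity_le.
  by rewrite -mpolyC0; apply: slp_cost_leC.
rewrite mulSn -addnA leq_add // (leq_trans (mpoly_size_rename _ _)) //.
by rewrite geq_max leq_addr leq_addl.
Qed.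

End Membership.

(** * Merging a list of polynomials into one *)

Section Packing.
Variables (K : fieldType) (m : nat) (L : seq {mpoly K[m]}).

(** The first [size L] variables are the selectors Y_j; the last [m] are the original ones. *)
Definition packed : {mpoly K[size L + m]} :=
  \sum_(j < size L) 'X_(lshift m j) * rename (@rshift (size L) m) L`_j.

Definition unpack (i : nat) (v : 'I_(size L + m) + K) : 'I_m + K :=
  match v with
  | inl q => match split q with
             | inl j => inr (j == i :> nat)%:R
             | inr p => inl p
             end
  | inr c => inr c
  end.

Lemma packed_subst t (Z : 'I_(t * t) -> 'I_(size L + m) + K) (i : nat) (v : 'I_m -> K) :
    packed = subst_mpoly Z (det_mpoly K t) ->
  (subst_mpoly (unpack i \o Z) (det_mpoly K t)).@[v] = (L`_i).@[v].
Proof.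
move=> packedE.
(* The selectors form the [i]-th unit vector; substituting through [unpack i] and evaluating at [v]
   amounts to evaluating [packed] at [y]. *)
pose y (q : 'I_(size L + m)) :=
  match split q with inl j => (j == i :> nat)%:R | inr p => v p end.
transitivity packed.@[y].
  rewrite packedE !meval_subst; apply: meval_eq => p /=.
  by rewrite /y; case: (Z p) => [q|//] /=; case: split.
have termE (j : 'I_(size L)) :
    ('X_(lshift m j) * rename (@rshift (size L) m) L`_j).@[y] =
    (j == i :> nat)%:R * (L`_j).@[v].
  rewrite mevalM mevalXU /rename meval_subst /y.
  have -> : split (lshift m j) = inl j := unsplitK (inl j).
  congr (_ * _); apply: meval_eq => p.
  by have -> : split (rshift (size L) p) = inr p := unsplitK (inr p).
rewrite raddf_sum /= (eq_bigr _ (fun j _ => termE j)).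
(* Past the end of the list all selectors are 0, in agreement with the default value of [nth]. *)
have [lt_i|ge_i] := ltnP i (size L).
  rewrite (bigD1 (Ordinal lt_i)) //= eqxx mul1r big1 ?addr0 // => j ne_ji.
  by rewrite (_ : _ == _ = false) ?mul0r //; apply/negbTE.
rewrite nth_default // raddf0 big1 // => j _.
by rewrite (ltn_eqF (leq_trans (ltn_ord j) ge_i)) mul0r.
Qed.

Lemma packed_degree : (mpoly_degree packed <= (\sum_(P <- L) mpoly_size P).+1)%N.
Proof.
suff : (msize packed <= (\sum_(P <- L) mpoly_size P).+2)%N by rewrite /mpoly_degree; lia.
apply: leq_trans (mmeasure_sum _ _ _ _) _; apply/bigmax_leqP_seq => j _ _.
apply: leq_trans (msizeM_field_le _ _) _; rewrite msizeX mdeg1.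
have := msize_subst_le (fun i : 'I_m => inl (rshift (size L) i)) L`_j.
have : (mpoly_size L`_j <= \sum_(P <- L) mpoly_size P)%N.
  by rewrite (big_nth 0) big_mkord (bigD1 j) //= leq_addr.
by rewrite /rename /mpoly_size /mpoly_degree; lia.
Qed.

Lemma packed_complexity :
  (slp_complexity packed <= (3 * \sum_(P <- L) mpoly_size P).+1)%N.
Proof.
pose c (j : 'I_(size L)) := (0 + slp_complexity L`_j).+1.
apply: leq_trans (slp_complexity_le (slp_cost_le_sum (c := c) _)) _.
  by move=> j; apply: slp_cost_leM (slp_cost_leX _) (slp_cost_le_rename _ _).
rewrite ltnS big_distrr /= (big_nth 0) big_mkord leq_sum // => j _.
(* Each term adds one product and one addition to the cost of its polynomial; as sizes are positive,
   three times the size covers all of it. *)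
have arith a b : (0 < b -> a <= b -> (0 + a).+2 <= 3 * b)%N by lia.
exact: arith (mpoly_size_gt0 _) (leq_maxr _ _).
Qed.

Lemma size_le_sum_mpoly_size : (size L <= \sum_(P <- L) mpoly_size P)%N.
Proof. by rewrite -sum1_size leq_sum // => P _; apply: mpoly_size_gt0. Qed.

End Packing.

(** * Reducing to the weighted determinant *)

Section Hardness.
Variable K : numFieldType.

(** The value is the image of a natural number with these bits as binary digits, and the naturals
    embed in [K]. *)
Lemma weighted_det_inj (N : nat) (A B : 'I_N -> 'M[K]_N) :
  weighted_det A = weighted_det B ->
  forall i, (\det (A i) == 0) = (\det (B i) == 0).
Proof.
pose bit (C : 'I_N -> 'M[K]_N) (k : nat) :=
  if insub k is Some j then \det (C j) == 0 else false.
have wdE C : weighted_det C = (\sum_(i < N) 2 ^ i.+1 * bit C i)%N%:R.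
  rewrite natr_sum; apply: eq_bigr => i _.
  by rewrite natrM natrX /bit valK.
rewrite !wdE => /eqP; rewrite eqr_nat => /eqP e i.
by have := sum_pow2_inj e (ltn_ord i); rewrite /bit valK.
Qed.

(* Padding by an identity block makes room for k determinants of size t in one
   weighted determinant of order t + k. *)
Definition pad_subst (m t k : nat) (W : nat -> 'M['I_m + K]_t) :
    'rV['I_m + K]_((t + k) * ((t + k) * (t + k))) :=
  mxvec (\matrix_(i < t + k) mxvec (block_mx (W i) (const_mx (inr 0))
    (const_mx (inr 0)) (map_mx inr (1%:M : 'M[K]_k)))).

(** With the substitution stored as a row vector over ['I_m + K], evaluation at [x] is a [map_mx],
    which commutes with reshaping and block formation; the identity block contributes a factor 1. *)
Lemma subst_pad (m t k : nat) (W : nat -> 'M['I_m + K]_t) (x : 'rV[K]_m) :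
  let ev v := match v with inl j => x 0 j | inr c => c end in
  exists2 A : 'I_(t + k) -> 'M[K]_(t + k),
    subst_fun (pad_subst k W 0) (@weighted_det_seq K (t + k)) x = weighted_det A &
    forall i, \det (A i) = \det (map_mx ev (W i)).
Proof.
move=> ev; exists (fun i => block_mx (map_mx ev (W i)) 0 0 1%:M); last first.
  by move=> i; rewrite det_lblock det1 mulr1.
rewrite /subst_fun /weighted_det_seq; congr weighted_det; apply/funext => i.
have -> : \row_p (match pad_subst k W 0 p with inl j => x 0 j | inr c => c end) =
    map_mx ev (pad_subst k W) by apply/rowP => p; rewrite !mxE.
rewrite /pad_subst -map_vec_mx mxvecK -map_row rowK -map_vec_mx mxvecK map_block_mx.
by congr block_mx; apply/matrixP => p q; rewrite !mxE.
Qed.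

Lemma refines_Par (n : nat) (f g : 'rV[K]_n -> K) :
  (forall x y, g x = g y -> f x = f y) -> refines (Par g) (Par f).
Proof.
move=> gf _ [_ [x _ <-] <-].
exists (f @^-1` [set f x])%classic; first by exists (f x) => //; exists x.
by move=> y /= /gf.
Qed.

Lemma VPC_hard_weighted_det :
  VP_complete (@det_mpoly K) -> forall (m : nat -> nat)
    (f : forall n, 'rV[K]_(m n) -> K),
  in_VPC f -> fun_reduces f (@weighted_det_seq K).
Proof.
move=> [_ det_hard] m f [pm _ [F [Ff bF]]].
pose L n := atoms (F n).
have bL : poly_bounded (fun n => \sum_(P <- L n) mpoly_size P)%N.
  by apply: poly_bounded_le bF _ => n _; rewrite formula_sizeE.
have bk : poly_bounded (fun n => size (L n)).
  by apply: poly_bounded_le bL _ => n _; apply: size_le_sum_mpoly_size.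
have [|t [bt red]] := det_hard (fun n => size (L n) + m n)%N (fun n => packed (L n)).
  split; first exact: poly_boundedD bk (poly_nat_bounded pm).
    apply: poly_bounded_le (poly_boundedD bL (poly_boundedC 1)) _ => n _.
    by rewrite addn1 packed_degree.
  apply: poly_bounded_le
    (poly_boundedD (poly_boundedM (poly_boundedC 3) bL) (poly_boundedC 1)) _ => n _.
  by rewrite addn1 packed_complexity.
(* The order has to accommodate determinants of order [t n] and also provide at least [size (L n)]
   blocks. *)
exists (fun n => t n + size (L n))%N; split; first exact: poly_boundedD bt bk.
move=> n n0; have [t0 [Z packedE]] := red n n0; split; first by rewrite addn_gt0 t0.
pose W (i : nat) : 'M_(t n) := vec_mx (\row_p (unpack i \o Z) p).
exists (pad_subst (size (L n)) W 0).
apply: refines_Par => x y.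
have [A -> detA] := subst_pad (size (L n)) W x.
have [B -> detB] := subst_pad (size (L n)) W y.
have detW z i : \det (map_mx
    (fun v : 'I_(m n) + K => match v with inl j => z 0 j | inr c => c end) (W i)) =
    ((L n)`_i).@[z 0].
  rewrite -(packed_subst i (z 0) packedE) meval_subst_det map_vec_mx.
  by congr (\det (vec_mx _)); apply/rowP => p; rewrite !mxE.
(* Equal codes mean that each atom vanishes at both [x] and [y] or at neither. *)
move=> /weighted_det_inj eqAB; rewrite -!Ff //.
apply: formula_val_atoms => P /(nthP 0)[i lt_i <-].
have lt_i' : (i < t n + size (L n))%N by apply: leq_trans lt_i (leq_addl _ _).
by have := eqAB (Ordinal lt_i'); rewrite detA detB !detW.
Qed.

End Hardness.

Theorem theorem2p59 (R : realType)
    (hdet : VP_complete (@det_mpoly (complex R))) :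
  VPC_complete (@weighted_det_seq (complex R)).
Proof.
split; first by case: hdet => VPdet _; apply: in_VPC_weighted_det VPdet.
exact: VPC_hard_weighted_det hdet.
Qed.
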